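(* Let $k\ge 1$ be an integer and let $\mathrm{sw}_k(x)=\sum_{n\ge 0}\mathrm{sw}_{n,k}x^n$ be the generating function for the number $\mathrm{sw}_{n,k}$ of smooth words of length $n$ over the alphabet $[k]$. Then $$\mathrm{sw}_k(x)=1+\frac{x\bigl(k-(3k+2)x\bigr)}{(1-3x)^2}+\frac{2x^2}{(1-3x)^2}\cdot\frac{1+U_{k-1}\left(\frac{1-x}{2x}\right)}{U_k\left(\frac{1-x}{2x}\right)}.$$
   Context: $[k]=\{1,2,\ldots,k\}$, and $[k]^n$ is the set of words $\sigma=\sigma_1\cdots\sigma_n$ of length $n$ over $[k]$. A word $\sigma\in[k]^n$ is smooth if $|\sigma_{i+1}-\sigma_i|\le 1$ for all $1\le i\le n-1$. The empty word ($n=0$) counts as one smooth word, so $\mathrm{sw}_{0,k}=1$, and $\mathrm{sw}_{1,k}=k$. $U_r$ is the Chebyshev polynomial of the second kind, $U_r(\cos\theta)=\sin((r+1)\theta)/\sin\theta$; equivalently $U_0(t)=1$, $U_1(t)=2t$, $U_r(t)=2tU_{r-1}(t)-U_{r-2}(t)$. The right-hand side is a rational function of $x$, and the identity means that the formal power series $\mathrm{sw}_k(x)$ is the expansion of this rational function at $x=0$. *)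

(* Defs.v *)
From HB Require Import structures.
From mathcomp Require Import all_boot all_order all_algebra.

Set Implicit Arguments.
Unset Strict Implicit.
Unset Printing Implicit Defensive.
Import Order.TTheory GRing.Theory Num.Theory.
Local Open Scope ring_scope.

(* The ordinal i : 'I_k encodes the letter i + 1 of [k]; the shift does not
   affect differences of letters. *)
Definition adjacent (k : nat) : rel 'I_k :=
  fun a b => `|(b : nat)%:Z - (a : nat)%:Z| <= 1.

Definition smooth (n k : nat) (w : n.-tuple 'I_k) : bool :=
  sorted (@adjacent k) w.

Definition sw (n k : nat) : nat := #|[set w : n.-tuple 'I_k | smooth w]|.

Fixpoint chebyshevU (R : nzRingType) (r : nat) : {poly R} :=
  match r with
  | 0 => 1
  | r1.+1 => match r1 with
             | 0 => 2%:R *: 'X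
             | r2.+1 => 2%:R *: 'X * chebyshevU R r1 - chebyshevU R r2
             end
  end.

Notation ratfun := {fraction {poly rat}}.

(* A formal power series over rat is given by its coefficient sequence [a].
   [is_expansion_at0 a F]: the rational function F is regular at 0, F = p / q
   with q(0) != 0, and q * (\sum_n a n x^n) = p as formal power series (Cauchy
   product).  As q is invertible among the power series, F determines a. *)
Definition is_expansion_at0 (a : nat -> rat) (F : ratfun) : Prop :=
  exists p q : {poly rat},
    [/\ q.[0] != 0,
        F = tofrac p / tofrac q
      & forall n : nat, \sum_(i < n.+1) q`_i * a (n - i)%N = p`_n].

Definition xF : ratfun := tofrac 'X.

(* Main.v *)
Require Import Defs.
From mathcomp Require Import all_boot all_order all_algebra.
From mathcomp Require Import zify ring.
Import Order.TTheory GRing.Theory Num.Theory.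
Local Open Scope ring_scope.

(** For a letter [j], let [F_j] be the generating function of the words that
may follow [j] in a smooth word.  Deleting the first letter of such a word gives
the linear system [F_j = 1 + x (F_(j-1) + F_j + F_(j+1))], in which the
letters outside the alphabet contribute zero ([card_continuations_S]).

The system is solved with a common denominator.  Let
[E_m = x^(m-1) U_(m-1)((1-x)/(2x))], a polynomial in [x] with
[E_(m+2) = (1-x) E_(m+1) - x^2 E_m].  The three-term recurrence makes both
[x^(-m) E_m] and its mirror image under [m -> k+1-m] solutions of the
homogeneous system, and the constant [1/(1-3x)] is a particular solution of the
full one; imposing zero at positions [0] and [k+1] yields
[(1-3x) E_(k+1) F_m = E_(k+1) - x^(k+1-m) E_m - x^m E_(k+1-m)]
([numerator_rec]).  The product of the denominator with the series of counts and
the coefficient sequence of the numerator obey the same recurrence, so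
they coincide ([continuations_expansion]).

Summing over the [k] letters leaves one sum, [\sum_m x^(k+1-m) E_m], and
[1-3x] times it telescopes to [x E_(k+1) - x^(k+1) - x^2 E_k]
([sum_homogeneous]).  Rewriting [E_(k+1)] and [E_k] in terms of [U_k] and
[U_(k-1)] gives the formula ([closed_form]). *)

(** * Homogenized Chebyshev polynomials *)

(** [scaledU x m] stands for [x^(m-1) U_(m-1)((1-x)/(2x))]; the shift of the
index provides the boundary value [U_(-1) = 0]. *)
Fixpoint scaledU (R : comNzRingType) (x : R) (m : nat) : R :=
  match m with
  | 0 => 0
  | m1.+1 => match m1 with
             | 0 => 1
             | m2.+1 => (1 - x) * scaledU R x m1 - x ^+ 2 * scaledU R x m2
             end
  end.
Arguments scaledU {R} x m.

Lemma scaledUSS (R : comNzRingType) (x : R) m :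
  scaledU x m.+2 = (1 - x) * scaledU x m.+1 - x ^+ 2 * scaledU x m.
Proof. by []. Qed.

Lemma rmorph_scaledU (R S : comNzRingType) (f : {rmorphism R -> S}) (x : R) m :
  f (scaledU x m) = scaledU (f x) m.
Proof.
suff [] : f (scaledU x m) = scaledU (f x) m
       /\ f (scaledU x m.+1) = scaledU (f x) m.+1 by [].
elim: m => [|m [IH0 IH1]]; first by rewrite /= rmorph0 rmorph1.
by split=> //; rewrite !scaledUSS rmorphB !rmorphM rmorphB rmorph1 IH0 IH1.
Qed.

Lemma scaledU0 (R : comNzRingType) m : scaledU (0 : R) m.+1 = 1.
Proof.
elim: m => [//|m IHm].
by rewrite scaledUSS IHm subr0 mul1r expr0n mul0r subr0.
Qed.

Lemma chebyshevUSS (R : nzRingType) r :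
  chebyshevU R r.+2 = 2%:R *: 'X * chebyshevU R r.+1 - chebyshevU R r.
Proof. by []. Qed.

Lemma scaledU_chebyshevU (R : comNzRingType) (x t : R) r :
  2%:R * x * t = 1 - x -> x ^+ r * (chebyshevU R r).[t] = scaledU x r.+1.
Proof.
move=> xt.
suff [] : x ^+ r * (chebyshevU R r).[t] = scaledU x r.+1
       /\ x ^+ r.+1 * (chebyshevU R r.+1).[t] = scaledU x r.+2 by [].
elim: r => [|r [IH0 IH1]].
  by rewrite /= hornerC hornerZ hornerX -xt; split; ring.
split=> //; rewrite scaledUSS -IH1 -IH0 -xt chebyshevUSS.
by rewrite hornerD hornerN -scalerAl hornerZ hornerM hornerX !exprS; ring.
Qed.

(** * The system solved by the generating functions *)

(** The numerator of [F_m]; positions [1..k] are the letters, and it vanishes at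
the two positions [0] and [k+1] next to the alphabet. *)
Definition numerator (R : comNzRingType) (x : R) (k m : nat) : R :=
  scaledU x k.+1 - x ^+ (k.+1 - m) * scaledU x m
    - x ^+ m * scaledU x (k.+1 - m).
Arguments numerator {R} x k m.

Definition denominator (R : comNzRingType) (x : R) (k : nat) : R :=
  (1 - 3%:R * x) * scaledU x k.+1.
Arguments denominator {R} x k.

Lemma numerator_first (R : comNzRingType) (x : R) k : numerator x k 0 = 0.
Proof. by rewrite /numerator subn0 mulr0 subr0 mul1r subrr. Qed.

Lemma numerator_last (R : comNzRingType) (x : R) k : numerator x k k.+1 = 0.
Proof. by rewrite /numerator subnn mulr0 subr0 mul1r subrr. Qed.

(** The part [scaledU x k.+1] accounts for [denominator x k]; the other two
solve the homogeneous recurrence in [i], each by the recurrence of [scaledU]. *)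
Lemma numerator_rec (R : comNzRingType) (x : R) k i : (i < k)%N ->
  numerator x k i.+1 = denominator x k
    + x * (numerator x k i + numerator x k i.+1 + numerator x k i.+2).
Proof.
move=> lt_ik; have [j ->] : exists j, k = (i + j).+1.
  by exists (k - i.+1)%N; lia.
rewrite /numerator /denominator.
have -> : ((i + j).+2 - i = j.+2)%N by lia.
have -> : ((i + j).+2 - i.+1 = j.+1)%N by lia.
have -> : ((i + j).+2 - i.+2 = j)%N by lia.
(* Keeps the value at k+1 folded: it cancels as a whole. *)
set e := scaledU x (i + j).+2.
rewrite (scaledUSS _ x i) (scaledUSS _ x j) !exprS.
ring.
Qed.

(** Induction on [k]: the sum for [k + 1] is [x] times the sum for [k] plus
[x * scaledU x k.+1], and the right-hand side obeys the same recurrence. *)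
Lemma sum_homogeneous (R : comNzRingType) (x : R) k :
  (1 - 3%:R * x) * (\sum_(i < k) x ^+ (k - i) * scaledU x i.+1)
  = x * scaledU x k.+1 - x ^+ k.+1 - x ^+ 2 * scaledU x k.
Proof.
elim: k => [|k IHk]; first by rewrite big_ord0 /=; ring.
rewrite big_ord_recr /= subSnn.
under eq_bigr => i _ do rewrite (subSn (ltnW (ltn_ord i))) exprS -mulrA.
rewrite -mulr_sumr mulrDr mulrCA IHk -/(scaledU x k.+1) !exprS.
ring.
Qed.

(** The two homogeneous parts are mirror images of each other, hence have the
same sum over the letters. *)
Lemma sum_numerator (R : comNzRingType) (x : R) k :
  (1 - 3%:R * x) * (\sum_(i < k) numerator x k i.+1)
  = (1 - 3%:R * x) * (k%:R * scaledU x k.+1)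
    - 2%:R * (x * scaledU x k.+1 - x ^+ k.+1 - x ^+ 2 * scaledU x k).
Proof.
rewrite -sum_homogeneous.
set S := \sum_(i < k) x ^+ (k - i) * _.
suff -> : \sum_(i < k) numerator x k i.+1 = k%:R * scaledU x k.+1 - S - S.
  by ring.
rewrite /numerator !sumrB sumr_const card_ord mulr_natl; congr (_ - _ - _).
rewrite (reindex_inj rev_ord_inj) /=; apply: eq_bigr => i _.
have lt_ik := ltn_ord i.
by congr (_ ^+ _ * scaledU _ _); lia.
Qed.

(** Multiplying through by [x^k] turns the Chebyshev quotient
[(1 + U_(k-1)) / U_k] into [(x^k + x E_k) / E_(k+1)], with
[E_m = scaledU x m]; [sum_numerator] then makes both sides rational
expressions in [x], [x^k], [E_k] and [E_(k+1)]. *)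
Lemma closed_form (F : fieldType) (x : F) (k : nat) :
  let U r := (chebyshevU F r).[(1 - x) / (2%:R * x)] in
  (1 <= k)%N -> x != 0 -> (2%:R : F) != 0 -> 1 - 3%:R * x != 0 ->
  scaledU x k.+1 != 0 ->
  1 + x * (k%:R - (3 * k + 2)%:R * x) / (1 - 3%:R * x) ^+ 2
    + 2%:R * x ^+ 2 / (1 - 3%:R * x) ^+ 2 * ((1 + U k.-1) / U k)
  = (denominator x k + x * \sum_(i < k) numerator x k i.+1) / denominator x k.
Proof.
move=> U; case: k => // k _ x0 two0 d0 e0.
have xU r : x ^+ r * U r = scaledU x r.+1.
  by apply: scaledU_chebyshevU; rewrite mulrC divfK ?mulf_neq0.
have xk0 : x ^+ k != 0 by rewrite expf_neq0.
have -> : U k = scaledU x k.+1 / x ^+ k by rewrite -xU mulrC mulKf.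
have -> : U k.+1 = scaledU x k.+2 / (x * x ^+ k).
  by rewrite -exprS -xU mulrC mulKf ?expf_neq0.
have -> : \sum_(i < k.+1) numerator x k.+1 i.+1
  = ((1 - 3%:R * x) * (k.+1%:R * scaledU x k.+2)
      - 2%:R * (x * scaledU x k.+2 - x ^+ k.+2 - x ^+ 2 * scaledU x k.+1))
     / (1 - 3%:R * x).
  by rewrite -sum_numerator mulrC mulKf.
rewrite /denominator !exprS natrD natrM.
move: e0; set e := scaledU x k.+2; set e1 := scaledU x k.+1 => e0.
field.
by rewrite e0 d0 xk0 x0.
Qed.

(** * Counting smooth words *)

(** Words that may follow the letter [j], rather than words starting with [j]:
the count is then 1, not 0, for length zero. *)
Definition continuations (k n : nat) (j : 'I_k) : {set n.-tuple 'I_k} :=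
  [set w : n.-tuple 'I_k | path (@adjacent k) j w].
Arguments continuations {k} n j.

Lemma card_tupleS (T : finType) n (P : pred (seq T)) :
  #|[set w : n.+1.-tuple T | P w]|
  = (\sum_(x : T) #|[set w : n.-tuple T | P (x :: w)]|)%N.
Proof.
rewrite -sum1dep_card.
under [RHS]eq_bigr do rewrite -sum1dep_card.
rewrite pair_big_dep /=.
rewrite (reindex (fun p : T * n.-tuple T => cons_tuple p.1 p.2)) //=.
exists (fun w : n.+1.-tuple T => (thead w, [tuple of behead w])).
  by case=> x w _; congr (_, _); apply/val_inj.
by move=> w _; rewrite [RHS]tuple_eta; apply/val_inj.
Qed.

Lemma sw0 k : sw 0 k = 1.
Proof.
rewrite /sw (_ : [set _ | _] = setT) ?cardsT ?card_tuple //.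
by apply/setP=> w; rewrite !inE /smooth tuple0.
Qed.

Lemma swS n k : sw n.+1 k = (\sum_(j : 'I_k) #|continuations n j|)%N.
Proof. exact: (card_tupleS _ _ (sorted (@adjacent k))). Qed.

Lemma card_continuations0 k (j : 'I_k) : #|continuations 0 j| = 1%N.
Proof.
rewrite /continuations (_ : [set _ | _] = setT) ?cardsT ?card_tuple //.
by apply/setP=> w; rewrite !inE tuple0.
Qed.

Lemma card_continuations_S k n (j : 'I_k) :
  #|continuations n.+1 j|
  = (\sum_(l : 'I_k | adjacent j l) #|continuations n l|)%N.
Proof.
rewrite [LHS](card_tupleS _ _ (path (@adjacent k) j)) [RHS]big_mkcond /=.
apply: eq_bigr => l _; case: ifP => jl; last first.
  by apply/eqP; rewrite cards_eq0; apply/eqP/setP=> w; rewrite !inE.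
by apply: eq_card => w; rewrite !inE.
Qed.

Lemma sum_adjacent (V : nmodType) (g : nat -> V) k (j : 'I_k) :
    g 0%N = 0 -> g k.+1 = 0 ->
  \sum_(l : 'I_k | adjacent j l) g l.+1 = g j + g j.+1 + g j.+2.
Proof.
move=> g0 gk; have lt_jk := ltn_ord j.
pose near m := (j <= m < j.+3)%N.
(* Adding the two positions outside the alphabet turns the range into a full
   window of three positions, wherever j lies. *)
transitivity (\sum_(m < k.+2 | near m) g m).
  rewrite big_mkcond [RHS]big_mkcond big_ord_recl big_ord_recr /= g0 gk.
  rewrite !if_same add0r addr0; apply: eq_bigr => l _.
  by congr (if _ then _ else _); rewrite /adjacent /near /bump /=; lia.
rewrite -(big_mkord near g) /near.
transitivity (\sum_(j <= m < j.+3) g m).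
  rewrite [RHS](big_nat_widenl _ 0%N) // [RHS](big_nat_widen _ _ k.+2) //; lia.
by rewrite !big_nat_recr ?big_geq /= ?add0r //; lia.
Qed.

(** * Comparison of coefficients *)

(** Induction on [n]: splitting off the first letter turns the convolution at
[n + 1] into the convolutions at [n] for the adjacent letters, plus one
coefficient of the denominator, as in [numerator_rec]. *)
Lemma continuations_expansion k n (j : 'I_k) :
  \sum_(i < n.+1) (denominator ('X : {poly rat}) k)`_i
                    * #|continuations (n - i) j|%:R
  = (numerator ('X : {poly rat}) k j.+1)`_n.
Proof.
set q := denominator _ _.
elim: n j => [|n IHn] j; rewrite numerator_rec // -/q coefD coefXM.
  by rewrite big_ord_recl big_ord0 card_continuations0 mulr1.
rewrite /= big_ord_recr /= subnn card_continuations0 mulr1 addrC; congr (_ + _).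
rewrite -(sum_adjacent _ (numerator 'X k)) ?numerator_first ?numerator_last //.
rewrite coef_sum; under [RHS]eq_bigr do rewrite -IHn.
rewrite exchange_big /=; apply: eq_bigr => i _.
by rewrite subSn -1?ltnS // card_continuations_S natr_sum mulr_sumr.
Qed.

Lemma sw_expansion k n :
  let q := denominator ('X : {poly rat}) k in
  \sum_(i < n.+1) q`_i * (sw (n - i) k)%:R
  = (q + 'X * \sum_(j < k) numerator 'X k j.+1)`_n.
Proof.
move=> q; rewrite coefD coefXM big_ord_recr /= subnn sw0 mulr1 addrC.
congr (_ + _); case: n => [|n] /=; first by rewrite big_ord0.
rewrite coef_sum; under [RHS]eq_bigr do rewrite -continuations_expansion.
rewrite exchange_big /=; apply: eq_bigr => i _.
by rewrite subSn -1?ltnS // swS natr_sum mulr_sumr.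
Qed.

Theorem theorem2p2 (k : nat) (hk : (1 <= k)%N) :
  let x : ratfun := xF in
  let U (r : nat) : ratfun := (chebyshevU ratfun r).[(1 - x) / (2%:R * x)] in
  is_expansion_at0 (fun n : nat => (sw n k)%:R)
    (1 + x * (k%:R - (3 * k + 2)%:R * x) / (1 - 3%:R * x) ^+ 2
       + 2%:R * x ^+ 2 / (1 - 3%:R * x) ^+ 2 * ((1 + U k.-1) / U k)).
Proof.
move=> x U; pose X : {poly rat} := 'X.
pose q := denominator X k; pose G := \sum_(j < k) numerator X k j.+1.
(* The denominators are nonzero because they take the value 1 at x = 0. *)
have scaledU_at0 : (scaledU X k.+1).[0] = 1.
  rewrite -[LHS]/(horner_eval 0 (scaledU X k.+1)) rmorph_scaledU.
  by rewrite [Z in scaledU Z _](_ : _ = 0) ?scaledU0 //; exact: hornerX.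
have d_at0 : (1 - 3%:R * X).[0] = 1.
  by rewrite hornerD hornerN hornerM hornerX mulr0 subr0 hornerC.
have q_at0 : q.[0] = 1.
  by rewrite /q /denominator hornerM scaledU_at0 d_at0 mulr1.
have nz_at0 (p : {poly rat}) : p.[0] = 1 -> tofrac p != 0.
  move=> p1; rewrite tofrac_eq0; apply/eqP=> p0.
  by move: p1; rewrite p0 horner0 => /eqP; rewrite eq_sym oner_eq0.
exists (q + X * G), q; split; last exact: sw_expansion.
  by rewrite q_at0 oner_neq0.
have x0 : x != 0 by rewrite tofrac_eq0 polyX_eq0.
have natE m : (m%:R : ratfun) = tofrac m%:R by rewrite rmorph_nat.
have two0 : (2%:R : ratfun) != 0.
  by rewrite natE tofrac_eq0 -polyC_natr polyC_eq0.
have dE : tofrac (1 - 3%:R * X) = 1 - 3%:R * x.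
  by rewrite tofracB tofracM tofrac1 natE.
have d0 : 1 - 3%:R * x != 0 by rewrite -dE; apply: nz_at0.
have scaledUE m : tofrac (scaledU X m) = scaledU x m.
  by rewrite (rmorph_scaledU _ _ (@tofrac _)).
have e0 : scaledU x k.+1 != 0 by rewrite -scaledUE; apply: nz_at0.
have qE : tofrac q = denominator x k by rewrite tofracM dE scaledUE.
have numE m : tofrac (numerator X k m) = numerator x k m.
  by rewrite !tofracB !tofracM !tofracXn !scaledUE.
have pE : tofrac (q + X * G)
    = denominator x k + x * \sum_(j < k) numerator x k j.+1.
  rewrite tofracD qE tofracM rmorph_sum /=; congr (_ + _ * _).
  by apply: eq_bigr => j _; rewrite numE.
rewrite pE qE; exact: (closed_form _ x k hk x0 two0 d0 e0).
Qed.
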